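(* Let $a,b,c,d>0$ and consider the axis-aligned 4-Quad patch whose nine nodes are the points $(x,y)$ with $x\in\{-c,0,a\}$ and $y\in\{-d,0,b\}$, the central node $i$ being the origin. Put $R_x=\frac{\min(a,c)}{a+c}$ and $R_y=\frac{\min(b,d)}{b+d}$. Then for every bilinear function $p\in\mathbb{Q}_1(\mathbb{R}^2)$, $$p_i-p_i^{\min}\;\le\;\left(\frac{1}{R_xR_y}-1\right)\bigl(p_i^{\max}-p_i\bigr),$$ where $p_i=p(0,0)$ and $p_i^{\min}$, $p_i^{\max}$ are the minimum and maximum of $p$ over the surrounding nodes of the patch. In particular, this holds at every interior node $i\in\{1,\dots,m\}$ of a mesh whose patch is of this form (with coordinates centred at node $i$).
   Context: $\mathbb{Q}_1(\mathbb{R}^2)$ is the space of functions $p(x,y)=\alpha+\beta x+\gamma y+\delta xy$ with real coefficients. The surrounding nodes are the eight nodes of the patch other than the central node $(0,0)$. The patch consists of the four rectangles obtained by cutting $[-c,a]\times[-d,b]$ along the coordinate axes. $R_x$ and $R_y$ are called the linear eccentricities of the patch. *)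

(* Defs.v *)
From HB Require Import structures.
From mathcomp Require Import all_boot all_order all_algebra.
From mathcomp Require Import all_classical all_reals all_analysis.
Set Implicit Arguments.
Unset Strict Implicit.
Unset Printing Implicit Defensive.
Import Order.TTheory GRing.Theory Num.Theory.
Import numFieldNormedType.Exports.
Local Open Scope classical_set_scope.
Local Open Scope ring_scope.

Definition Q1 (R : realType) : set (R * R -> R) :=
  [set p | exists alpha beta gamma delta : R, forall x y : R,
     p (x, y) = alpha + beta * x + gamma * y + delta * x * y].

Definition linear_eccentricity (R : realType) (a c : R) : R :=
  Num.min a c / (a + c).

(* Seeding the fold with the first value makes these the true minimum and
   maximum of every nonempty list; only the value 0 on the empty list is
   arbitrary. *)
Definition min_over (R : realType) (p : R * R -> R) (s : seq (R * R)) : R :=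
  let v := [seq p q | q <- s] in \big[Num.min/head 0 v]_(z <- v) z.

Definition max_over (R : realType) (p : R * R -> R) (s : seq (R * R)) : R :=
  let v := [seq p q | q <- s] in \big[Num.max/head 0 v]_(z <- v) z.

Definition quad4_nodes (R : realType) (a b c d : R) : seq (R * R) :=
  [seq (x, y) | x <- [:: - c; 0; a], y <- [:: - d; 0; b]].

Definition quad4_surrounding (R : realType) (a b c d : R) : seq (R * R) :=
  [seq q <- quad4_nodes a b c d | q != (0, 0)].

Definition quad4_rectangles (R : realType) (a b c d : R) : set (set (R * R)) :=
  [set I `*` J | I in [set `[- c, 0]%classic; `[0, a]%classic] & J in [set `[- d, 0]%classic; `[0, b]%classic]].

Definition hull (R : realType) (n : nat) (x : 'I_n -> R * R) (K : {set 'I_n}) :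
    set (R * R) :=
  [set q | exists w : 'I_n -> R,
     [/\ forall j, 0 <= w j,
         \sum_(j in K) w j = 1,
         q.1 = \sum_(j in K) w j * (x j).1 &
         q.2 = \sum_(j in K) w j * (x j).2]].

(* A cell is given by the set of its vertices, which are in strictly convex
   position: this determines a nondegenerate convex polygon. The cells are
   arbitrary such polygons, so quadrilateral, triangular and mixed meshes are
   all covered. Together, the bound of two common vertices and
   [mesh_conforming] say that distinct cells meet in nothing, in a common
   vertex or in a common edge. The nodes numbered 0, ..., mesh_m - 1 are the
   interior ones, the domain being the union of the cells. *)
Record mesh (R : realType) := Mesh {
  mesh_size : nat;
  mesh_m : nat;
  node : 'I_mesh_size -> R * R;
  cells : {set {set 'I_mesh_size}};
  node_inj : injective node;
  mesh_m_le : (mesh_m <= mesh_size)%N;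
  node_in_cell : forall i, exists2 K, K \in cells & i \in K;
  cell_card : forall K, K \in cells -> (3 <= #|K|)%N;
  cell_convex : forall K j, K \in cells -> j \in K ->
    ~ hull node (K :\ j)%SET (node j);
  mesh_conforming : forall K L, K \in cells -> L \in cells ->
    hull node K `&` hull node L = hull node (K :&: L)%SET;
  mesh_share : forall K L, K \in cells -> L \in cells -> K != L ->
    (#|K :&: L| <= 2)%N;
  mesh_interior : forall i : 'I_mesh_size,
    (i < mesh_m)%N <->
    interior (\bigcup_(K in [set` cells]) hull node K) (node i)
}.

Definition patch_cells (R : realType) (M : mesh R) (i : 'I_(mesh_size M)) :
    {set {set 'I_(mesh_size M)}} :=
  [set K in cells M | i \in K]%SET.

Definition patch_nodes (R : realType) (M : mesh R) (i : 'I_(mesh_size M)) :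
    {set 'I_(mesh_size M)} :=
  finset.cover (patch_cells i).

Definition surrounding_nodes (R : realType) (M : mesh R)
    (i : 'I_(mesh_size M)) : seq (R * R) :=
  [seq node j | j <- enum (patch_nodes i :\ i)%SET].

Definition centred (R : realType) (M : mesh R) (i : 'I_(mesh_size M))
    (q : R * R) : R * R :=
  (q.1 - (node i).1, q.2 - (node i).2).

Definition is_quad4_patch (R : realType) (M : mesh R) (i : 'I_(mesh_size M))
    (a b c d : R) : Prop :=
  [set centred i @` hull (@node R M) K | K in [set` patch_cells i]]
    = quad4_rectangles a b c d
  /\ [set centred i (node j) | j in [set` patch_nodes i]]
    = [set` quad4_nodes a b c d].

(* Main.v *)
Require Import Defs.
From HB Require Import structures.
From mathcomp Require Import all_boot all_order all_algebra.
From mathcomp Require Import all_classical all_reals all_analysis.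
From mathcomp Require Import ring.
Import Order.TTheory GRing.Theory Num.Theory.
Local Open Scope classical_set_scope.
Local Open Scope ring_scope.

(** Each one-dimensional node [s] can be balanced against a nonzero node [s']:
    the origin is the barycentre of [s] and [s'], and [s] carries a weight at
    least equal to the linear eccentricity ([balancing_node]). Since a bilinear
    function is affine in each variable, taking products of such weights writes
    [p (0, 0)] as a convex combination of the values of [p] at the four points
    [(s, t)], [(s, t')], [(s', t)], [(s', t')] ([Q1_origin_combination]), in
    which [p (s, t)] has a weight at least [r = Rx * Ry]. If [(s, t)] is not the
    origin then, [s'] and [t'] being nonzero, all four points are surrounding
    nodes. With [M] the maximum of [p] over these nodes, the terms of the
    corresponding combination of the numbers [M - p _] are nonnegative, so
    [r * (M - p (s, t)) <= M - p (0, 0)]. For [(s, t)] a node at which the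
    minimum is attained this is the claimed inequality, multiplied by [r] and
    rearranged.

    For a node of a mesh, translation to that node preserves bilinearity and
    carries the surrounding nodes to those of the reference patch, by
    injectivity of the numbering of the nodes. *)

Section Patch.
Variable R : realType.
Implicit Types (p : R * R -> R) (S : seq (R * R)) (q : R * R).

Lemma min_over_attained p S q0 :
  q0 \in S -> exists2 q, q \in S & min_over p S = p q.
Proof.
case: S => // q1 S _; apply/mapP; rewrite /min_over /=.
rewrite big_seq; elim/big_ind: _ => //; first exact: mem_head.
by move=> x y xS yS; rewrite minElt; case: ifP.
Qed.

Lemma le_max_over p S q : q \in S -> p q <= max_over p S.
Proof.
move=> qS; rewrite /max_over.
by apply: (le_bigmax_seq _ (p q)) => //; exact: map_f.
Qed.

Lemma linear_eccentricity_gt0 (a c : R) :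
  0 < a -> 0 < c -> 0 < linear_eccentricity a c.
Proof. by move=> a0 c0; rewrite divr_gt0 ?addr_gt0// lt_min a0. Qed.

(** For [s = 0] the weight is [1] and any nonzero [s'] would do. Requiring
    [s' != 0] in all cases is what keeps the origin out of the four points of
    [Q1_origin_combination]. *)
Lemma balancing_node (a c s : R) : 0 < a -> 0 < c -> s \in [:: - c; 0; a] ->
  exists s' l : R, [/\ s' \in [:: - c; 0; a], s' != 0,
    linear_eccentricity a c <= l, l <= 1 & l * s + (1 - l) * s' = 0].
Proof.
move=> a0 c0; have ac0 : 0 < a + c by rewrite addr_gt0.
have ac_neq0 : a + c != 0 by rewrite gt_eqF.
rewrite /linear_eccentricity !inE => /or3P[] /eqP ->.
- exists a, (a / (a + c)); split.
  + by rewrite !inE eqxx !orbT.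
  + by rewrite gt_eqF.
  + by rewrite ler_pM2r ?invr_gt0// ge_min lexx.
  + by rewrite ler_pdivrMr// mul1r lerDl ltW.
  + by field.
- exists a, 1; split => //.
  + by rewrite !inE eqxx !orbT.
  + by rewrite gt_eqF.
  + by rewrite ler_pdivrMr// mul1r ge_min lerDl ltW.
  + by ring.
- exists (- c), (c / (a + c)); split.
  + by rewrite !inE eqxx.
  + by rewrite oppr_eq0 gt_eqF.
  + by rewrite ler_pM2r ?invr_gt0// ge_min lexx orbT.
  + by rewrite ler_pdivrMr// mul1r lerDr ltW.
  + by field.
Qed.

Lemma Q1_origin_combination p (s s' t t' l m : R) : Q1 p ->
  l * s + (1 - l) * s' = 0 -> m * t + (1 - m) * t' = 0 ->
  p (0, 0) = l * m * p (s, t) + l * (1 - m) * p (s, t')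
    + (1 - l) * m * p (s', t) + (1 - l) * (1 - m) * p (s', t').
Proof.
move=> [al [be [ga [de pE]]]] hs ht; rewrite !pE.
(* Being affine in each variable, [p] commutes with both barycentres: the
   right-hand side is the value of [p] at the pair of barycentres. *)
transitivity (al + be * (l * s + (1 - l) * s') + ga * (m * t + (1 - m) * t')
  + de * (l * s + (1 - l) * s') * (m * t + (1 - m) * t')); last by ring.
by rewrite hs ht.
Qed.

Lemma Q1_translate p q : Q1 p -> Q1 (fun z => p (z.1 + q.1, z.2 + q.2)).
Proof.
move=> [al [be [ga [de pE]]]].
exists (al + be * q.1 + ga * q.2 + de * q.1 * q.2), (be + de * q.2),
  (ga + de * q.1), de => x y /=.
by rewrite pE; ring.
Qed.

Lemma mem_quad4_nodes (a b c d x y : R) :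
  ((x, y) \in quad4_nodes a b c d) =
  (x \in [:: - c; 0; a]) && (y \in [:: - d; 0; b]).
Proof.
apply/allpairsP/andP => [[[x' y'] [/= x'P y'P [-> ->]]]//|[xP yP]].
by exists (x, y).
Qed.

(** Measuring values downwards from an upper bound makes every term of the
    convex combination nonnegative, so all but the one at [q] can be dropped. *)
Lemma surrounding_gap (a b c d : R) p (M : R) q :
  0 < a -> 0 < b -> 0 < c -> 0 < d -> Q1 p ->
  (forall z, z \in quad4_surrounding a b c d -> p z <= M) ->
  q \in quad4_surrounding a b c d ->
  linear_eccentricity a c * linear_eccentricity b d * (M - p q)
    <= M - p (0, 0).
Proof.
move=> a0 b0 c0 d0 pQ1 pM; case: q => s t qS; have := qS.
rewrite mem_filter mem_quad4_nodes => /and3P[st0 sN tN].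
have [s' [l [s'N s'0 Rxl l1 hs]]] := balancing_node _ _ _ a0 c0 sN.
have [t' [m [t'N t'0 Rym m1 ht]]] := balancing_node _ _ _ b0 d0 tN.
have Rx0 := linear_eccentricity_gt0 _ _ a0 c0.
have Ry0 := linear_eccentricity_gt0 _ _ b0 d0.
have l0 : 0 <= l by rewrite (le_trans (ltW Rx0)).
have m0 : 0 <= m by rewrite (le_trans (ltW Ry0)).
have gap x y : x \in [:: - c; 0; a] -> y \in [:: - d; 0; b] ->
    (x != 0) || (y != 0) -> 0 <= M - p (x, y).
  move=> xN yN xy0; rewrite subr_ge0 pM// mem_filter mem_quad4_nodes xN yN.
  by rewrite xpair_eqE negb_and xy0.
have -> : M - p (0, 0) = l * m * (M - p (s, t)) + l * (1 - m) * (M - p (s, t'))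
    + (1 - l) * m * (M - p (s', t)) + (1 - l) * (1 - m) * (M - p (s', t')).
  by rewrite (Q1_origin_combination _ _ _ _ _ _ _ pQ1 hs ht); ring.
apply: (@le_trans _ _ (l * m * (M - p (s, t)))).
  by rewrite ler_wpM2r ?subr_ge0 ?pM// ler_pM// ltW.
have l1' : 0 <= 1 - l by rewrite subr_ge0.
have m1' : 0 <= 1 - m by rewrite subr_ge0.
by rewrite -!addrA lerDl !addr_ge0// mulr_ge0 ?gap ?s'0 ?t'0 ?orbT// mulr_ge0.
Qed.

(** Only the set of surrounding nodes matters, which allows for the arbitrary
    order in which a mesh enumerates them. *)
Lemma patch_bound (a b c d : R) p S :
  0 < a -> 0 < b -> 0 < c -> 0 < d -> Q1 p ->
  S =i quad4_surrounding a b c d ->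
  p (0, 0) - min_over p S <=
    ((linear_eccentricity a c * linear_eccentricity b d)^-1 - 1)
      * (max_over p S - p (0, 0)).
Proof.
move=> a0 b0 c0 d0 pQ1 SE.
have aS : (a, 0) \in S.
  by rewrite SE mem_filter mem_quad4_nodes !inE !eqxx !orbT xpair_eqE gt_eqF.
have [q qS ->] := min_over_attained p S _ aS.
have r0 : 0 < linear_eccentricity a c * linear_eccentricity b d.
  by rewrite mulr_gt0// linear_eccentricity_gt0.
have gap : linear_eccentricity a c * linear_eccentricity b d
    * (max_over p S - p q) <= max_over p S - p (0, 0).
  apply: surrounding_gap => //; last by rewrite -SE.
  by move=> z zS; rewrite le_max_over ?SE.
rewrite mulrBl mul1r lerBrDr addrC addrA subrK.
by rewrite mulrC ler_pdivlMr// mulrC.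
Qed.

Lemma centred_surrounding_nodes (M : mesh R) (i : 'I_(mesh_size M))
    (a b c d : R) : is_quad4_patch i a b c d ->
  map (centred i) (surrounding_nodes i) =i quad4_surrounding a b c d.
Proof.
move=> [_ nodesE].
have centred_inj : injective (fun j : 'I_(mesh_size M) => centred i (node j)).
  move=> j k [e1 e2]; apply: (@node_inj R M).
  move/addIr: e1 => e1; move/addIr: e2 => e2.
  by rewrite [LHS]surjective_pairing e1 e2 -surjective_pairing.
have centred_self : centred i (node i) = (0, 0) by rewrite /centred !subrr.
move=> q; rewrite -map_comp mem_filter; apply/mapP/andP.
- move=> [j]; rewrite mem_enum finset.in_setD1 => /andP[ji jP] ->; split.
    by rewrite -centred_self (inj_eq centred_inj).
  suff : [set` quad4_nodes a b c d] (centred i (node j)) by [].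
  by rewrite -nodesE; exists j.
- move=> [q0 qN].
  have : [set` quad4_nodes a b c d] q by [].
  rewrite -nodesE => -[j jP jq]; exists j => //.
  rewrite mem_enum finset.in_setD1 andbC; apply/andP; split => //.
  by apply: contra_neq q0 => ji; rewrite -jq ji.
Qed.

End Patch.

Theorem theorem22 (R : realType) (a b c d : R)
    (ha : 0 < a) (hb : 0 < b) (hc : 0 < c) (hd : 0 < d) :
  let Rx := linear_eccentricity a c in
  let Ry := linear_eccentricity b d in
  (forall p : R * R -> R, Q1 p ->
     let S := quad4_surrounding a b c d in
     p (0, 0) - min_over p S <=
       ((Rx * Ry)^-1 - 1) * (max_over p S - p (0, 0)))
  /\
  (forall (M : mesh R) (i : 'I_(mesh_size M)), (i < mesh_m M)%N ->
     is_quad4_patch i a b c d ->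
     forall p : R * R -> R, Q1 p ->
       let S := surrounding_nodes i in
       p (node i) - min_over p S <=
         ((Rx * Ry)^-1 - 1) * (max_over p S - p (node i))).
Proof.
move=> Rx Ry; split=> [p pQ1|M i _ patch_i p pQ1]; first exact: patch_bound.
set S := surrounding_nodes i; rewrite /=.
set p' := fun z : R * R => p (z.1 + (node i).1, z.2 + (node i).2).
have p'E : p' \o centred i =1 p.
  by move=> [x y]; rewrite /p' /centred /= !subrK.
have valuesE : map p' (map (centred i) S) = map p S.
  by rewrite -map_comp; exact: eq_map.
have p'0 : p' (0, 0) = p (node i).
  by rewrite /p' /= !add0r -surjective_pairing.
have := patch_bound _ _ _ _ _ _ _ ha hb hc hd (Q1_translate _ _ (node i) pQ1)
  (centred_surrounding_nodes _ _ _ _ _ _ _ patch_i).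
by rewrite -p'0 /min_over /max_over -valuesE.
Qed.
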